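(* Let $L$ be an oriented starred link or linkoid diagram in a surface, and let $L^*$ be its mirror image, obtained by only switching every crossing of $L$ (over strand exchanged with under strand, stars unchanged). Then $$\nabla_{L^*}(W)=\nabla_L(W^{-1}).$$
   Context: Surfaces are closed, connected and oriented. A linkoid diagram in a surface is a generic immersion of finitely many unit intervals (long components) and circles, with finitely many transverse double points, each carrying over/under information (crossings); endpoints of long components are distinct from each other and from the crossings; all components are oriented. A link diagram is the case with only circles. The universe is the graph obtained by turning each crossing into a 4-valent vertex and each endpoint into a 1-valent vertex; regions are the connected components of its complement. Diagrams are assumed tightly embedded (every region is a disk); every diagram in $S^2$ is counted as tightly embedded. A starred diagram is a diagram together with stars placed either on some of its regions or on some of its crossings (possibly no stars) so that the number of unstarred regions equals the number of unstarred crossings. Labels. At each crossing there are four local regions (corners): the out-corner (between the two outgoing edges), the in-corner (between the two incoming edges) and two side corners. At a positive crossing the out-corner has label $W$, the in-corner $-W^{-1}$, and both side corners $1$. At a negative crossing the out-corner has label $W^{-1}$, the in-corner $-W$, and both side corners $1$. A state of a starred diagram assigns to every unstarred region one marker, placed at a corner of that region at an unstarred crossing, so that every unstarred crossing receives exactly one marker (if a region occupies several corners at one crossing, different corners give different states). The weight of a state is the product of the labels of the marked corners. The mock Alexander polynomial $\nabla_L(W)$ is the sum of the weights of all states of $L$. *)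

(* Defs.v *)
From HB Require Import structures.
From mathcomp Require Import all_boot all_order all_algebra.

Set Implicit Arguments.
Unset Strict Implicit.
Unset Printing Implicit Defensive.
Import GRing.Theory.
Local Open Scope ring_scope.

(** Rational functions in one variable W over the integers.  The Laurent
    polynomials Z[W, W^-1] are the subring generated by W and W^-1.           *)

Definition ratfun := {fraction {poly int}}.

Definition W : ratfun := FracField.tofrac 'X.

Definition poly_at_Winv (p : {poly int}) : ratfun := (map_poly intr p).[W^-1].

(** The substitution f(W) |-> f(W^-1). By subst_WinvE below it does not depend
    on the choice of numerator and denominator.                               *)
Definition subst_Winv (f : ratfun) : ratfun :=
  poly_at_Winv (\n_(repr f)) / poly_at_Winv (\d_(repr f)).

Lemma W_neq0 : W != 0.
Proof. by rewrite tofrac_eq0 polyX_eq0. Qed.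

HB.instance Definition _ := GRing.RMorphism.copy poly_at_Winv
  (horner_eval W^-1 \o map_poly (intr : int -> ratfun)).

Lemma poly_at_Winv_eq0 (p : {poly int}) : (poly_at_Winv p == 0) = (p == 0).
Proof.
apply/idP/idP=> [/eqP p0|/eqP ->]; last by rewrite rmorph0.
have tofracE (c : int) : FracField.tofrac c%:P = c%:~R :> ratfun.
  by rewrite -[in LHS](intz c) !rmorph_int.
pose n := size p; pose q := \sum_(i < n) p`_i *: 'X^(n.-1 - i).
have q0 : q = 0.
  apply/eqP; rewrite -tofrac_eq0 -[0](mulr0 (W ^+ n.-1)) -p0 /poly_at_Winv.
  rewrite (horner_coef_wide _ (size_poly _ _)) -/n rmorph_sum mulr_sumr.
  apply/eqP/eq_bigr => i _; rewrite coef_map -mul_polyC rmorphM rmorphXn /=.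
  have le_in : (i <= n.-1)%N by rewrite -ltnS (ltn_predK (ltn_ord i)).
  rewrite tofracE mulrCA -[in RHS](subnK le_in) exprD -mulrA exprVn.
  by rewrite divff ?mulr1 // expf_neq0 // W_neq0.
apply: contraTT isT => p_neq0; have n_gt0 : (0 < n)%N by rewrite size_poly_gt0.
suff: lead_coef p = 0 by move/eqP; rewrite lead_coef_eq0 (negPf p_neq0).
have := congr1 (coefp 0) q0; rewrite /= coef0 coef_sum => <-.
have lt_n : (n.-1 < n)%N by rewrite prednK.
rewrite (bigD1 (Ordinal lt_n)) //= subnn expr0 coefZ coef1 mulr1 big1 ?addr0 //.
move=> i ne_i; rewrite coefZ coefXn eq_sym subn_eq0 leqNgt.
suff ->: (i < n.-1)%N by rewrite mulr0.
by rewrite ltn_neqAle -ltnS prednK // ltn_ord andbT.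
Qed.

Lemma ratfun_repr (f : ratfun) :
  f = FracField.tofrac (\n_(repr f)) / FracField.tofrac (\d_(repr f)).
Proof.
have d_neq0 : \d_(repr f) != 0 := denom_ratioP _.
apply: (@mulIf _ (FracField.tofrac \d_(repr f))); first by rewrite tofrac_eq0.
rewrite divfK ?tofrac_eq0 //.
change (FracField.mul f (FracField.tofrac \d_(repr f))
        = FracField.tofrac \n_(repr f)).
elim/quotW: f {d_neq0} => x; rewrite !piE; apply/eqmodP.
rewrite /= FracField.equivfE /FracField.mulf.
rewrite !numden_Ratio ?oner_eq0 ?mulr1 ?mulf_neq0 ?oner_eq0 ?denom_ratioP //.
by rewrite FracField.equivf_r.
Qed.

Lemma subst_WinvE (p q : {poly int}) : q != 0 ->
  subst_Winv (FracField.tofrac p / FracField.tofrac q)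
  = poly_at_Winv p / poly_at_Winv q.
Proof.
move=> q_neq0; set f := _ / _; rewrite /subst_Winv.
have d_neq0 : \d_(repr f) != 0 := denom_ratioP _.
apply/eqP; rewrite GRing.eqr_div ?poly_at_Winv_eq0 // -!rmorphM /=.
suff ->: \n_(repr f) * q = p * \d_(repr f) by [].
apply/eqP; rewrite -tofrac_eq !tofracM -GRing.eqr_div ?tofrac_eq0 //.
by rewrite -ratfun_repr.
Qed.

Lemma subst_Winv_is_zmod_morphism : zmod_morphism subst_Winv.
Proof.
move=> f g; rewrite [f]ratfun_repr [g]ratfun_repr.
move: (repr f) (repr g) => x y.
have dx : \d_x != 0 := denom_ratioP _; have dy : \d_y != 0 := denom_ratioP _.
rewrite -mulNr addf_div ?tofrac_eq0 // mulNr -!tofracM -tofracB.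
rewrite !subst_WinvE ?mulf_neq0 // -[in RHS]mulNr.
by rewrite addf_div ?poly_at_Winv_eq0 // mulNr rmorphB !rmorphM.
Qed.

Lemma subst_Winv_is_monoid_morphism : monoid_morphism subst_Winv.
Proof.
split=> [|f g].
  rewrite -[1 in LHS](divff (oner_neq0 ratfun)) -tofrac1 subst_WinvE ?oner_eq0 //.
  by rewrite rmorph1 divff ?oner_eq0.
rewrite [f]ratfun_repr [g]ratfun_repr; move: (repr f) (repr g) => x y.
have dx : \d_x != 0 := denom_ratioP _; have dy : \d_y != 0 := denom_ratioP _.
rewrite mulf_div -!tofracM !subst_WinvE ?mulf_neq0 // mulf_div.
by rewrite !rmorphM.
Qed.

HB.instance Definition _ := GRing.isZmodMorphism.Build ratfun ratfun subst_Winv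
  subst_Winv_is_zmod_morphism.
HB.instance Definition _ := GRing.isMonoidMorphism.Build ratfun ratfun subst_Winv
  subst_Winv_is_monoid_morphism.

Lemma subst_Winv_W : subst_Winv W = W^-1.
Proof.
rewrite -[W in LHS]divr1 -tofrac1 subst_WinvE ?oner_eq0 //.
by rewrite rmorph1 divr1 /poly_at_Winv map_polyX hornerX.
Qed.

(** Generically immersed curves in a closed oriented surface are encoded by
    rotation systems.  The four half-edges at a crossing x are (x, 0), ...,
    (x, 3), in counterclockwise order, starting anywhere; there is one
    half-edge at each endpoint of a long component.  Circles that pass through
    no crossing contain no half-edge and are listed separately.               *)

Definition halfedge (X P : finType) : finType := (X * 'I_4 + P)%type.

(** A half-edge stands for its left side, seen when leaving its vertex;
    (o, true) and (o, false) are the left and right sides of a crossingless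
    circle o.                                                                 *)
Definition side (X P O : finType) : finType := (halfedge X P + O * bool)%type.

Definition turn_cw (X P : finType) (h : halfedge X P) : halfedge X P :=
  match h with
  | inl (x, i) => inl (x, i - 1)
  | inr p => inr p
  end.

(** Walking along a curve with a region on the left, one arrives at the next
    vertex through the other half of the edge and leaves it through the first
    half-edge found clockwise.  The orbits of next_side are the boundary curves
    of the regions.                                                           *)
Definition next_side (X P O : finType) (e : halfedge X P -> halfedge X P)
    (s : side X P O) : side X P O :=
  match s with
  | inl h => inl (turn_cw (e h))
  | inr c => inr c
  end.

Definition opp_side (X P O : finType) (e : halfedge X P -> halfedge X P)
    (s : side X P O) : side X P O :=
  match s with
  | inl h => inl (e h)
  | inr (o, b) => inr (o, ~~ b)
  end.

(** The universe of a diagram, together with the regions of the surface: a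
    region is a sphere with holes, one for each boundary curve mapped to it by
    region_of.  No genus is recorded, since regions of positive genus occur
    neither in the sphere nor when all regions are disks.                     *)
Record universe := Universe {
  crossing : finType;
  endpoint : finType;
  circle : finType;
  region : finType;
  edge : halfedge crossing endpoint -> halfedge crossing endpoint;
  region_of : side crossing endpoint circle -> region;
  edgeK : involutive edge;
  edge_neq : forall h, edge h != h;
  region_of_next : forall s, region_of (next_side edge s) = region_of s
}.

Section Universe.
Variable U : universe.

Definition boundary_curves (r : region U) : nat :=
  fcard (@next_side _ _ (circle U) (@edge U)) [pred s | region_of s == r].

(** V - E + sum of the Euler characteristics of the open regions; crossingless
    circles contribute 0.                                                     *)
Definition euler_char : int :=
  #|crossing U|%:Z + #|endpoint U|%:Z
  - (fcard (@edge U) (halfedge (crossing U) (endpoint U)))%:Z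
  + \sum_(r : region U) (2 - (boundary_curves r)%:Z).

Definition adjacent_regions : rel (region U) :=
  fun r r' => [exists s, (region_of s == r)
                      && (region_of (opp_side (@edge U) s) == r')].

Definition connected_surface : Prop :=
  (0 < #|region U|)%N /\ forall r r', connect adjacent_regions r r'.

Definition regions_are_disks : Prop :=
  forall r : region U, boundary_curves r = 1%N.

(** For a connected closed surface. *)
Definition is_sphere : Prop := euler_char = 2.

Definition tightly_embedded : Prop := regions_are_disks \/ is_sphere.

(** The corner (x, i) lies between the half-edges (x, i) and (x, i + 1). *)
Definition corner : finType := (crossing U * 'I_4)%type.

Definition corner_region (c : corner) : region U := region_of (inl (inl c)).

End Universe.

(** Linkoid diagrams; link diagrams are those without endpoints.
    out h: the orientation of the component through h leaves the vertex of h.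
    overstrand c: the half-edge c at a crossing belongs to the over strand.   *)
Record diagram := Diagram {
  shadow :> universe;
  out : halfedge (crossing shadow) (endpoint shadow) -> bool;
  overstrand : crossing shadow * 'I_4 -> bool;
  shadow_connected : connected_surface shadow;
  shadow_tight : tightly_embedded shadow;
  out_edge : forall h, out (edge h) = ~~ out h;
  out_opp : forall x (i : 'I_4), out (inl (x, i + 2)) = ~~ out (inl (x, i));
  overstrand_next : forall x (i : 'I_4),
    overstrand (x, i + 1) = ~~ overstrand (x, i)
}.

Section Labels.
Variable D : diagram.

Definition out_at (c : corner D) : bool := out (inl c : halfedge _ _).

Definition ccw (c : corner D) : corner D := (c.1, c.2 + 1).

Definition out_corner (c : corner D) : bool := out_at c && out_at (ccw c).

Definition in_corner (c : corner D) : bool := ~~ out_at c && ~~ out_at (ccw c).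

(** Right-hand rule: the outgoing over half-edge is followed counterclockwise by
    the outgoing under half-edge.                                             *)
Definition positive (x : crossing D) : bool :=
  [exists i : 'I_4, overstrand (x, i) && out_corner (x, i)].

Definition label (c : corner D) : ratfun :=
  if out_corner c then (if positive c.1 then W else W^-1)
  else if in_corner c then (if positive c.1 then - W^-1 else - W)
  else 1.

End Labels.

Record starred_diagram := StarredDiagram {
  underlying :> diagram;
  star_regions : {set region underlying};
  star_crossings : {set crossing underlying};
  stars_one_kind : star_regions = set0 \/ star_crossings = set0;
  stars_balanced : #|~: star_regions| = #|~: star_crossings|
}.

Section States.
Variable L : starred_diagram.

Definition unstarred_region : finType :=
  {r : region L | r \notin star_regions L}.

Definition marking : finType := {ffun unstarred_region -> corner L}.

Definition is_state (s : marking) : bool :=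
  [&& [forall r, corner_region (s r) == val r],
      [forall r, (s r).1 \notin star_crossings L]
    & [forall x, (x \notin star_crossings L) ==>
                 (#|[set r | (s r).1 == x]| == 1%N)]].

Definition weight (s : marking) : ratfun := \prod_r label (s r).

Definition mock_alexander : ratfun := \sum_(s | is_state s) weight s.

End States.

Section Mirror.

Lemma mirror_overstrand_next (D : diagram) (x : crossing D) (i : 'I_4) :
  ~~ overstrand (x, i + 1) = ~~ ~~ overstrand (x, i).
Proof. by rewrite overstrand_next. Qed.

Definition mirror_diagram (D : diagram) : diagram :=
  Diagram (overstrand := fun c => ~~ overstrand c)
    (shadow_connected D) (shadow_tight D)
    (@out_edge D) (@out_opp D) (@mirror_overstrand_next D).

Definition mirror (L : starred_diagram) : starred_diagram :=
  @StarredDiagram (mirror_diagram L) (star_regions L) (star_crossings L)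
    (@stars_one_kind L) (@stars_balanced L).

End Mirror.

(* Main.v *)
(** In cyclic order the half-edges at a crossing are oriented a, b, ~ a, ~ b, so
    a crossing has exactly one out-corner. Its sign is therefore the over/under
    bit of the first half-edge of that corner, and the mirror image reverses it.
    Since labels of opposite signs are exchanged by W |-> W^-1, the identity
    holds label by label, and states are the same for L and its mirror image. *)
Require Import Defs.
From mathcomp Require Import all_boot all_order all_algebra.

Set Implicit Arguments.
Unset Strict Implicit.
Unset Printing Implicit Defensive.
Import GRing.Theory.
Local Open Scope ring_scope.

Section Sign.
Variable D : diagram.
Implicit Types (x : crossing D) (i j : 'I_4).

Lemma out_corner_inj x i j :
  out_corner (x, i) -> out_corner (x, j) -> i = j.
Proof.
rewrite /out_corner /out_at /ccw /=.
have [k ->] : exists k, j = i + k by exists (j - i); rewrite addrC subrK.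
have o2 := out_opp (d := D) x i; have o3 := out_opp (d := D) x (i + 1).
case/andP=> oi oi1; rewrite oi oi1 in o2 o3.
have -> : k = inord k by rewrite inord_val.
(* For [k] nonzero, the corner [i + k] uses half-edge [i + 2] or [i + 3], which points inwards,
   being opposite to an outgoing one. *)
case: k => [[|[|[|[|//]]]] lt_k] /=.
- by rewrite (_ : inord 0 = 0) ?addr0 //; apply/val_inj; rewrite /= inordK.
- rewrite (_ : inord 1 = 1); last by apply/val_inj; rewrite /= inordK.
  by rewrite -addrA [1 + 1](_ : _ = 2) // o2 andbF.
- rewrite (_ : inord 2 = 2); last by apply/val_inj; rewrite /= inordK.
  by rewrite o2.
- rewrite (_ : inord 3 = 1 + 2); last by apply/val_inj; rewrite /= inordK.
  by rewrite addrA o3.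
Qed.

Lemma in_corner_opp x i : in_corner (x, i) -> out_corner (x, i + 2).
Proof.
by rewrite /in_corner /out_corner /out_at /ccw /= addrAC !out_opp.
Qed.

Lemma positive_out_corner x i :
  out_corner (x, i) -> positive x = overstrand (x, i).
Proof.
move=> oi; apply/existsP/idP => [[j /andP[over_j oj]]|over_i].
  by rewrite (out_corner_inj oi oj).
by exists i; rewrite over_i.
Qed.

End Sign.

Lemma positive_mirror (D : diagram) (x : crossing D) (i : 'I_4) :
  out_corner (x, i) ->
  @positive (mirror_diagram D) x = ~~ positive x.
Proof.
move=> oi; rewrite (positive_out_corner oi).
exact: (@positive_out_corner (mirror_diagram D) x i).
Qed.

Lemma label_mirror (D : diagram) (c : corner D) :
  @label (mirror_diagram D) c = subst_Winv (label c).
Proof.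
case: c => x i; rewrite /label.
(* Switching keeps [out], so out- and in-corners agree by conversion. *)
rewrite -[@out_corner (mirror_diagram D) _]/(@out_corner D (x, i)).
rewrite -[@in_corner (mirror_diagram D) _]/(@in_corner D (x, i)) /=.
have [oi|_] := ifP.
  rewrite (positive_mirror oi).
  by case: positive; rewrite /= ?fmorphV /= subst_Winv_W ?invrK.
(* The sign flip needs an out-corner as witness: the one opposite to this in-corner serves. *)
have [/in_corner_opp oi|_] := ifP; last by rewrite rmorph1.
rewrite (positive_mirror oi).
by case: positive; rewrite /= rmorphN ?fmorphV /= subst_Winv_W ?invrK.
Qed.

Theorem proposition7 (L : starred_diagram) :
  mock_alexander (mirror L) = subst_Winv (mock_alexander L).
Proof.
rewrite /mock_alexander rmorph_sum; apply: eq_bigr => s _.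
by rewrite /weight rmorph_prod; apply: eq_bigr => r _; exact: label_mirror.
Qed.
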